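(* For any $d_1\ge2$ and $d_2\ge4$ there exists a decomposable map $P:\mathcal{M}_{d_1}\to\mathcal{M}_{d_2}$ such that $P\otimes P$ is positive and not decomposable.
   Context: A linear map $L:\mathcal{M}_{n}\to\mathcal{M}_{m}$ is positive if it maps positive semidefinite matrices to positive semidefinite matrices, and decomposable if $L=T+\vartheta_m\circ S$ for completely positive $T,S$, with $\vartheta_m$ the transpose on $\mathcal{M}_m$. *)

(* Defs.v *)
From HB Require Import structures.
From mathcomp Require Import all_boot all_order all_algebra.
From mathcomp Require Import complex mxtens.
From mathcomp Require Import Rstruct.
Set Implicit Arguments. Unset Strict Implicit. Unset Printing Implicit Defensive.
Import Order.TTheory GRing.Theory Num.Theory.
Local Open Scope ring_scope.
Local Open Scope complex_scope.

Definition C : Type := (Rdefinitions.R)[i].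

Definition adjmx {m n : nat} (A : 'M[C]_(m, n)) : 'M[C]_(n, m) :=
  map_mx Num.conj A^T.

Definition psd {n : nat} (A : 'M[C]_n) : Prop :=
  adjmx A = A /\ forall v : 'cV[C]_n, 0 <= (adjmx v *m A *m v) 0 0.

Definition is_lin {n m : nat} (L : 'M[C]_n -> 'M[C]_m) : Prop :=
  forall (a : C) (X Y : 'M[C]_n), L (a *: X + Y) = a *: L X + L Y.

Definition positive_map {n m : nat} (L : 'M[C]_n -> 'M[C]_m) : Prop :=
  forall A : 'M[C]_n, psd A -> psd (L A).

(* tensor product L1 (x) L2 : M_(n1 n2) = M_n1 (x) M_n2 -> M_(m1 m2),
   defined on the matrix units E_ab (x) E_cd and extended linearly;
   the Kronecker product is mxtens' tensmx ( *t ). *)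
Definition tens_map {n1 m1 n2 m2 : nat}
  (L1 : 'M[C]_n1 -> 'M[C]_m1) (L2 : 'M[C]_n2 -> 'M[C]_m2) :
  'M[C]_(n1 * n2) -> 'M[C]_(m1 * m2) :=
  fun X => \sum_(a < n1) \sum_(b < n1) \sum_(c < n2) \sum_(d < n2)
     X (mxtens_index (a, c)) (mxtens_index (b, d))
       *: tensmx (L1 (delta_mx a b)) (L2 (delta_mx c d)).

Definition completely_positive {n m : nat} (L : 'M[C]_n -> 'M[C]_m) : Prop :=
  is_lin L /\ forall k : nat, positive_map (tens_map (@id 'M[C]_k) L).

Definition decomposable {n m : nat} (L : 'M[C]_n -> 'M[C]_m) : Prop :=
  exists T S : 'M[C]_n -> 'M[C]_m,
    completely_positive T /\ completely_positive S /\
    forall X, L X = T X + (S X)^T.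

(* Main.v *)
Require Import Defs.
From mathcomp Require Import all_boot all_order all_algebra.
From mathcomp Require Import complex mxtens Rstruct spectral.
From mathcomp Require Import ring.
Set Implicit Arguments. Unset Strict Implicit. Unset Printing Implicit Defensive.
Import Order.TTheory GRing.Theory Num.Theory.
Local Open Scope ring_scope.

(** Let [P X] be the block diagonal sum of [6 X + tr X] and [2 X + 2 X^T + tr X],
applied to the leading 2x2 corner of [X].  Up to compressions, [P (x) P] is the sum
of the four tensor products of these qubit maps.

Positivity: let Psi and Phi be the 2x2 matrices of the input and of the test vector, and
[d = |det Psi det Phi|].  Each of the nine products of [id], transposition and trace gives
a quadratic form that is bounded below by a multiple of [d]: [id (x) id] and its
transposition by 0, the two partial transpositions by [- 2 d], the forms with one trace
by [2 d], and the double trace by [4 d].  For the partial transpositions and the single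
traces this is AM-GM applied to the entries of a product such as [Phi^* Psi], whose
determinant has modulus [d].

Non-decomposability: the sum of the projectors on six products of Bell vectors is
a state whose partial transpose is again such a sum (a PPT lattice state of
Benatti, Floreanini and Piani), so it pairs nonnegatively with the Choi matrix of every
decomposable map, but its pairing with the product of the two different qubit maps is -8. *)

(** * Adjoints and positive semidefinite matrices *)

Lemma adjmxE m n (A : 'M[C]_(m, n)) i j : adjmx A i j = (A j i)^*.
Proof. by rewrite !mxE. Qed.

Lemma adjmxM m n p (A : 'M[C]_(m, n)) (B : 'M[C]_(n, p)) :
  adjmx (A *m B) = adjmx B *m adjmx A.
Proof. by rewrite /adjmx trmx_mul map_mxM. Qed.

Lemma adjmxD m n (A B : 'M[C]_(m, n)) : adjmx (A + B) = adjmx A + adjmx B.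
Proof. by apply/matrixP=> i j; rewrite !mxE rmorphD. Qed.

Lemma adjmxZ m n a (A : 'M[C]_(m, n)) : adjmx (a *: A) = a^* *: adjmx A.
Proof. by apply/matrixP=> i j; rewrite !mxE rmorphM. Qed.

Lemma adjmxK m n (A : 'M[C]_(m, n)) : adjmx (adjmx A) = A.
Proof. by apply/matrixP=> i j; rewrite !mxE conjCK. Qed.

Lemma adjmx_tens m n p q (A : 'M[C]_(m, n)) (B : 'M[C]_(p, q)) :
  adjmx (A *t B) = adjmx A *t adjmx B.
Proof. by apply/matrixP=> i j; rewrite !mxE rmorphM. Qed.

Lemma psd_conj m n (K : 'M[C]_(m, n)) (A : 'M[C]_n) :
  psd A -> psd (K *m A *m adjmx K).
Proof.
move=> [hA pA]; split; first by rewrite !adjmxM adjmxK hA mulmxA.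
by move=> v; have := pA (adjmx K *m v); rewrite adjmxM adjmxK !mulmxA.
Qed.

Lemma psd0 n : psd (0 : 'M[C]_n).
Proof.
split; first by apply/matrixP=> i j; rewrite !mxE rmorph0.
by move=> v; rewrite mulmx0 mul0mx mxE.
Qed.

Lemma psdD n (A B : 'M[C]_n) : psd A -> psd B -> psd (A + B).
Proof.
move=> [hA pA] [hB pB]; split; first by rewrite adjmxD hA hB.
by move=> v; rewrite mulmxDr mulmxDl mxE addr_ge0.
Qed.

Lemma psd_sum n (I : finType) (A : I -> 'M[C]_n) :
  (forall i, psd (A i)) -> psd (\sum_i A i).
Proof.
by move=> hA; elim/big_ind: _ => [||i _]; [exact: psd0|exact: psdD|exact: hA].
Qed.

Lemma psdZ n (a : C) (A : 'M[C]_n) : 0 <= a -> psd A -> psd (a *: A).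
Proof.
move=> a0 [hA pA]; split; first by rewrite adjmxZ hA geC0_conj.
by move=> v; rewrite -scalemxAr -scalemxAl mxE mulr_ge0.
Qed.

Lemma psd_outer n (v : 'cV[C]_n) : psd (v *m adjmx v).
Proof.
split; first by rewrite adjmxM adjmxK.
move=> w; have -> : adjmx w *m (v *m adjmx v) *m w =
    (adjmx w *m v) *m adjmx (adjmx w *m v) by rewrite adjmxM adjmxK !mulmxA.
by rewrite mxE big_ord1 adjmxE mul_conjC_ge0.
Qed.

(** Spectral theorem for the normal matrix [A]; an eigenvalue is the value of the form at its unit
    eigenvector, hence nonnegative. *)
Lemma psd_spectral n (A : 'M[C]_n) : psd A ->
  exists (d : 'I_n -> C) (u : 'I_n -> 'cV[C]_n),
    (forall k, 0 <= d k) /\ A = \sum_k d k *: (u k *m adjmx (u k)).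
Proof.
move=> [hA pA]; set U := spectralmx A; set D := spectral_diag A.
have nA : A \is normalmx.
  by apply/normalmxP; rewrite -[map_mx _ _]/(adjmx A) hA.
have UU := spectral_unitarymx A.
have eA : A = adjmx U *m diag_mx D *m U.
  by rewrite {1}(orthomx_spectralP nA) invmx_unitary.
exists (fun k => D 0 k), (fun k => adjmx (row k U)); split.
  (* By unitarity the form at the adjoint of row [k] of [U] reduces to the [k]-th diagonal entry of
     [D]. *)
  have rU k : row k U *m adjmx U = (delta_mx 0 k : 'rV[C]_n).
    by rewrite -row_mul (unitarymxP UU) row1.
  move=> k; have := pA (adjmx (row k U)); rewrite adjmxK {1}eA !mulmxA rU.
  have -> : (delta_mx 0 k : 'rV[C]_n) *m diag_mx D *m U *m adjmx (row k U) =
            (delta_mx 0 k *m diag_mx D) *m adjmx (row k U *m adjmx U).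
    by rewrite adjmxM adjmxK mulmxA.
  rewrite rU -rowE row_diag_mx -scalemxAl mxE.
  rewrite mxE (bigD1 k) //= big1 ?addr0; last first.
    by move=> j jk; rewrite mxE (negPf jk) andbF mul0r.
  by rewrite adjmxE !mxE !eqxx /= conjC1 !mulr1.
rewrite {1}eA mul_mx_diag; apply/matrixP=> i j.
rewrite mxE summxE; apply: eq_bigr => k _.
by rewrite !mxE big_ord1 !mxE conjCK mulrCA mulrA.
Qed.

(** * Linear maps and their tensor products *)

Lemma lin0 n m (L : 'M[C]_n -> 'M[C]_m) : is_lin L -> L 0 = 0.
Proof. by move=> /(_ (-1) 0 0); rewrite scaler0 addr0 scaleN1r addNr. Qed.

Lemma linD n m (L : 'M[C]_n -> 'M[C]_m) X Y :
  is_lin L -> L (X + Y) = L X + L Y.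
Proof. by move=> /(_ 1 X Y); rewrite !scale1r. Qed.

Lemma linZ n m (L : 'M[C]_n -> 'M[C]_m) a X :
  is_lin L -> L (a *: X) = a *: L X.
Proof. by move=> linL; have := linL a X 0; rewrite (lin0 linL) !addr0. Qed.

Lemma lin_sum n m (L : 'M[C]_n -> 'M[C]_m) (I : finType) (X : I -> 'M[C]_n) :
  is_lin L -> L (\sum_i X i) = \sum_i L (X i).
Proof.
by move=> linL; apply: (big_morph L (fun x y => linD x y linL) (lin0 linL)).
Qed.

(** By the spectral decomposition, a positive semidefinite input is a nonnegative combination of
    rank-one projectors. *)
Lemma positive_map_outer n m (L : 'M[C]_n -> 'M[C]_m) :
  is_lin L -> (forall u : 'cV_n, psd (L (u *m adjmx u))) -> positive_map L.
Proof.
move=> linL hL A /psd_spectral [d [u [d0 ->]]].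
rewrite lin_sum //; apply: psd_sum => k; rewrite linZ //.
exact: psdZ.
Qed.

Lemma is_lin_conj n m (K : 'M[C]_(m, n)) (K' : 'M[C]_(n, m)) :
  is_lin (fun X => K *m X *m K').
Proof. by move=> a X Y; rewrite mulmxDr mulmxDl -scalemxAr -scalemxAl. Qed.

Lemma is_linD n m (L M : 'M[C]_n -> 'M[C]_m) :
  is_lin L -> is_lin M -> is_lin (fun X => L X + M X).
Proof. by move=> hL hM a X Y; rewrite hL hM scalerDr addrACA. Qed.

Lemma is_linZ n m c (L : 'M[C]_n -> 'M[C]_m) :
  is_lin L -> is_lin (fun X => c *: L X).
Proof. by move=> hL a X Y; rewrite hL scalerDr !scalerA mulrC. Qed.

Lemma is_lin_sum n m (I : finType) (L : I -> 'M[C]_n -> 'M[C]_m) :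
  (forall i, is_lin (L i)) -> is_lin (fun X => \sum_i L i X).
Proof.
move=> hL a X Y; rewrite scaler_sumr -big_split; apply: eq_bigr => i _.
exact: hL.
Qed.

Lemma is_lin_comp n m p (L : 'M[C]_n -> 'M[C]_m) (M : 'M[C]_p -> 'M[C]_n) :
  is_lin L -> is_lin M -> is_lin (fun X => L (M X)).
Proof. by move=> hL hM a X Y; rewrite hM hL. Qed.

Lemma is_lin_tens_map n1 m1 n2 m2
  (L1 : 'M[C]_n1 -> 'M[C]_m1) (L2 : 'M[C]_n2 -> 'M[C]_m2) :
  is_lin (tens_map L1 L2).
Proof.
do 4![apply: is_lin_sum => ?] => a X Y.
by rewrite !mxE scalerDl scalerA.
Qed.

Lemma tensmxDl m n p q (A B : 'M[C]_(m, n)) (D : 'M[C]_(p, q)) :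
  (A + B) *t D = A *t D + B *t D.
Proof. by apply/matrixP=> i j; rewrite !mxE mulrDl. Qed.

Lemma tensmxDr m n p q (D : 'M[C]_(m, n)) (A B : 'M[C]_(p, q)) :
  D *t (A + B) = D *t A + D *t B.
Proof. by apply/matrixP=> i j; rewrite !mxE mulrDr. Qed.

Lemma tensmxZl m n p q a (A : 'M[C]_(m, n)) (B : 'M[C]_(p, q)) :
  (a *: A) *t B = a *: (A *t B).
Proof. by apply/matrixP=> i j; rewrite !mxE mulrA. Qed.

Lemma tensmxZr m n p q a (A : 'M[C]_(m, n)) (B : 'M[C]_(p, q)) :
  A *t (a *: B) = a *: (A *t B).
Proof. by apply/matrixP=> i j; rewrite !mxE mulrCA. Qed.

Lemma tensmx_suml m n p q (I : finType) (A : I -> 'M[C]_(m, n)) (B : 'M[C]_(p, q)) :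
  (\sum_i A i) *t B = \sum_i A i *t B.
Proof.
by apply: (big_morph (fun A => A *t B) (fun _ _ => tensmxDl _ _ _));
   rewrite tens0mx.
Qed.

Lemma tensmx_sumr m n p q (I : finType) (A : 'M[C]_(m, n)) (B : I -> 'M[C]_(p, q)) :
  A *t (\sum_i B i) = \sum_i A *t B i.
Proof.
by apply: (big_morph (fun B => A *t B) (fun _ _ => tensmxDr _ _ _));
   rewrite tensmx0.
Qed.

Lemma tens_delta_mx m n p q (a : 'I_m) (b : 'I_n) (c : 'I_p) (d : 'I_q) :
  delta_mx a b *t delta_mx c d =
  delta_mx (mxtens_index (a, c)) (mxtens_index (b, d)) :> 'M[C]_(m * p, n * q).
Proof.
apply/matrixP=> i j; case: (mxtens_indexP i) => i1 i2; case: (mxtens_indexP j) => j1 j2.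
rewrite tensmxE !mxE !(can_eq (@mxtens_indexK _ _)) !xpair_eqE -natrM mulnb.
by rewrite andbACA.
Qed.

Lemma tens_mx_decomp n1 n2 (X : 'M[C]_(n1 * n2)) :
  X = \sum_(a < n1) \sum_(b < n1) \sum_(c < n2) \sum_(d < n2)
        X (mxtens_index (a, c)) (mxtens_index (b, d))
          *: (delta_mx a b *t delta_mx c d).
Proof.
apply/matrixP=> i j; case: (mxtens_indexP i) => i1 i2; case: (mxtens_indexP j) => j1 j2.
rewrite summxE (bigD1 i1) //= summxE (bigD1 j1) //= summxE (bigD1 i2) //=.
rewrite summxE (bigD1 j2) //= mxE tensmxE !mxE !eqxx /= !mulr1.
rewrite !big1 ?addr0 // => k /negPf nk; repeat (rewrite summxE big1 // => ? _).
- by rewrite mxE tensmxE !mxE (eq_sym i1) nk mul0r mulr0.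
- by rewrite mxE tensmxE !mxE (eq_sym j1) nk andbF mul0r mulr0.
- by rewrite mxE tensmxE !mxE (eq_sym i2) nk mulr0 mulr0.
- by rewrite mxE tensmxE !mxE (eq_sym j2) nk andbF mulr0 mulr0.
Qed.

(** Product matrices span the tensor product. This reduces every identity about [tens_map] below to
    products, where [tens_mapT] applies. *)
Lemma lin_tens_ext n1 n2 m (F G : 'M[C]_(n1 * n2) -> 'M[C]_m) :
  is_lin F -> is_lin G ->
  (forall (A : 'M[C]_n1) (B : 'M[C]_n2), F (A *t B) = G (A *t B)) ->
  forall X, F X = G X.
Proof.
move=> hF hG hFG X; rewrite (tens_mx_decomp X).
do 4![rewrite !lin_sum //; apply: eq_bigr => ? _].
by rewrite !linZ // hFG.
Qed.

Lemma tens_mapT n1 m1 n2 m2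
  (L1 : 'M[C]_n1 -> 'M[C]_m1) (L2 : 'M[C]_n2 -> 'M[C]_m2) A B :
  is_lin L1 -> is_lin L2 -> tens_map L1 L2 (A *t B) = L1 A *t L2 B.
Proof.
move=> h1 h2; rewrite {2}(matrix_sum_delta A) {2}(matrix_sum_delta B).
rewrite (lin_sum _ h1) tensmx_suml; apply: eq_bigr => a _.
rewrite (lin_sum _ h1) tensmx_suml; apply: eq_bigr => b _.
rewrite (lin_sum _ h2) tensmx_sumr; apply: eq_bigr => c _.
rewrite (lin_sum _ h2) tensmx_sumr; apply: eq_bigr => d _.
by rewrite tensmxE (linZ _ _ h1) (linZ _ _ h2) tensmxZl tensmxZr scalerA.
Qed.

Lemma tens_map_unit n1 m1 n2 m2
  (L1 : 'M[C]_n1 -> 'M[C]_m1) (L2 : 'M[C]_n2 -> 'M[C]_m2) a b c d :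
  is_lin L1 -> is_lin L2 ->
  tens_map L1 L2 (delta_mx (mxtens_index (a, c)) (mxtens_index (b, d))) =
  L1 (delta_mx a b) *t L2 (delta_mx c d).
Proof. by move=> h1 h2; rewrite -tens_delta_mx tens_mapT. Qed.

(** * Completely positive maps and the Choi matrix *)

(** Tensoring with the identity turns conjugation by [K] into conjugation by [1 (x) K], which
    preserves positivity. *)
Lemma completely_positive_conj n m (K : 'M[C]_(m, n)) :
  completely_positive (fun X => K *m X *m adjmx K).
Proof.
have linK : is_lin (fun X => K *m X *m adjmx K) by exact: is_lin_conj.
split=> // k A pA.
rewrite (lin_tens_ext
  (G := fun X => (1%:M *t K) *m X *m adjmx ((1%:M : 'M[C]_k) *t K))).
- exact: psd_conj.
- exact: is_lin_tens_map.
- exact: is_lin_conj.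
move=> X Y; rewrite tens_mapT // adjmx_tens !tensmx_mul mul1mx.
by rewrite /adjmx trmx1 map_mx1 mulmx1.
Qed.

Lemma completely_positiveD n m (L M : 'M[C]_n -> 'M[C]_m) :
  completely_positive L -> completely_positive M ->
  completely_positive (fun X => L X + M X).
Proof.
move=> [lL pL] [lM pM]; have lLM := is_linD lL lM; split=> // k A pA.
rewrite (lin_tens_ext (G := fun X => tens_map id L X + tens_map id M X)).
- by apply: psdD; [exact: pL|exact: pM].
- exact: is_lin_tens_map.
- by apply: is_linD; exact: is_lin_tens_map.
- by move=> X Y; rewrite !tens_mapT // tensmxDr.
Qed.

Lemma completely_positiveZ n m c (L : 'M[C]_n -> 'M[C]_m) :
  0 <= c -> completely_positive L -> completely_positive (fun X => c *: L X).
Proof.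
move=> c0 [lL pL]; have lcL := is_linZ c lL; split=> // k A pA.
rewrite (lin_tens_ext (G := fun X => c *: tens_map id L X)).
- by apply: psdZ => //; exact: pL.
- exact: is_lin_tens_map.
- by apply: is_linZ; exact: is_lin_tens_map.
- by move=> X Y; rewrite !tens_mapT // tensmxZr.
Qed.

Lemma completely_positive_sum n m (I : finType) (L : I -> 'M[C]_n -> 'M[C]_m) :
  (forall i, completely_positive (L i)) ->
  completely_positive (fun X => \sum_i L i X).
Proof.
move=> hL; have lL : is_lin (fun X => \sum_i L i X).
  by apply: is_lin_sum => i; case: (hL i).
split=> // k A pA.
rewrite (lin_tens_ext (G := fun X => \sum_i tens_map id (L i) X)).
- by apply: psd_sum => i; case: (hL i) => _ /(_ k); exact.
- exact: is_lin_tens_map.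
- by apply: is_lin_sum => i; exact: is_lin_tens_map.
- move=> X Y; rewrite tens_mapT // tensmx_sumr; apply: eq_bigr => i _.
  by rewrite tens_mapT //; case: (hL i).
Qed.

Lemma eq_completely_positive n m (L M : 'M[C]_n -> 'M[C]_m) :
  (forall X, L X = M X) -> completely_positive L -> completely_positive M.
Proof.
move=> eLM [lL pL]; have lM : is_lin M by move=> a X Y; rewrite -!eLM lL.
split=> // k A pA; rewrite (lin_tens_ext (G := tens_map id L)).
- exact: pL.
- exact: is_lin_tens_map.
- exact: is_lin_tens_map.
- by move=> X Y; rewrite !tens_mapT // eLM.
Qed.

(** The form is evaluated at a vector indexed by an arbitrary finite type, so that qubit labels can
    later stand for coordinates. *)
Lemma psd_form n (A : 'M[C]_n) (I : finType) (e : I -> 'I_n) (v : I -> C) :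
  psd A -> 0 <= \sum_s \sum_t (v s)^* * v t * A (e s) (e t).
Proof.
move=> [_ pA]; pose w : 'cV[C]_n := \sum_s v s *: delta_mx (e s) 0.
have := pA w; have -> // : (adjmx w *m A *m w) 0 0 = \sum_s \sum_t (v s)^* * v t * A (e s) (e t).
rewrite /w mulmx_sumr summxE exchange_big /=; apply: eq_bigr => t _.
rewrite -scalemxAr mxE -colE mxE.
have -> : adjmx w = \sum_s (v s)^* *: delta_mx 0 (e s).
  apply/matrixP=> i j; rewrite adjmxE !summxE rmorph_sum; apply: eq_bigr => s _.
  by rewrite !mxE rmorphM rmorph_nat andbC.
rewrite mulmx_suml summxE mulr_sumr; apply: eq_bigr => s _.
by rewrite -scalemxAl mxE -rowE mxE mulrCA mulrA.
Qed.

(* The Choi matrix of [L] tested on the vector [\sum_s v s *: (e s (x) f s)]. *)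
Lemma completely_positive_choi n m (L : 'M[C]_n -> 'M[C]_m) (I : finType)
    (e : I -> 'I_n) (f : I -> 'I_m) (v : I -> C) :
  completely_positive L ->
  0 <= \sum_s \sum_t (v s)^* * v t * L (delta_mx (e s) (e t)) (f s) (f t).
Proof.
move=> [lL /(_ n) pL].
(* The unnormalised maximally entangled vector: [id (x) L] sends its projector to the Choi matrix of
   [L]. *)
pose w : 'cV[C]_(n * n) := \sum_a delta_mx (mxtens_index (a, a)) 0.
have := psd_form (fun s => mxtens_index (e s, f s)) v (pL _ (psd_outer w)).
have -> : tens_map id L (w *m adjmx w) = \sum_a \sum_b delta_mx a b *t L (delta_mx a b).
  rewrite /w mulmx_suml lin_sum; last exact: is_lin_tens_map.
  apply: eq_bigr => a _.
  have -> : adjmx w = \sum_b delta_mx 0 (mxtens_index (b, b)).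
    apply/matrixP=> i j; rewrite adjmxE !summxE rmorph_sum; apply: eq_bigr => s _.
    by rewrite !mxE rmorph_nat andbC.
  rewrite mulmx_sumr lin_sum; last exact: is_lin_tens_map.
  apply: eq_bigr => b _.
  by rewrite mul_delta_mx tens_map_unit.
congr (_ <= _); apply: eq_bigr => s _; apply: eq_bigr => t _; congr (_ * _).
rewrite summxE (bigD1 (e s)) //= summxE (bigD1 (e t)) //= tensmxE mxE !eqxx mul1r.
rewrite !big1 ?addr0 // => k /negPf nk; rewrite ?summxE ?big1 // => *.
all: by rewrite tensmxE mxE ![_ == k]eq_sym nk ?andbF mul0r.
Qed.

(** * The quadratic form of a product of two qubit maps *)

Lemma sum_ord2 (V : nmodType) (F : 'I_2 -> V) : \sum_i F i = F 0 + F 1.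
Proof. by rewrite big_ord_recl big_ord1; congr (_ + F _); apply: val_inj. Qed.

(** Entry [(k, l)] of [p X + q X^T + r tr X] at the matrix unit [E_ab]. Over a general ring, with
    conjugates replaced by independent variables, the form below is a polynomial identity. *)
Definition mix_coef (R : comNzRingType) (p q r : R) (a b k l : 'I_2) : R :=
  p * (a == k)%:R * (b == l)%:R + q * (a == l)%:R * (b == k)%:R
  + r * (a == b)%:R * (k == l)%:R.

Definition form_id_id (R : comNzRingType) (s s' f f' : 'I_2 -> 'I_2 -> R) :=
  (\sum_a \sum_c f' a c * s a c) * (\sum_a \sum_c f a c * s' a c).

Lemma sum_mix_coef (R : comNzRingType) (G : 'I_2 -> 'I_2 -> R) p q r k l :
  \sum_a \sum_b G a b * mix_coef p q r a b k l =
  p * G k l + q * G l k + r * (k == l)%:R * \sum_a G a a.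
Proof.
under eq_bigr do under eq_bigr do rewrite /mix_coef !mulrDr.
under eq_bigr do rewrite !big_split /=.
rewrite !big_split /=; congr (_ + _ + _).
- rewrite (bigD1 k) //= (bigD1 l) //= !eqxx !mulr1 mulrC !big1 ?addr0 //.
    by move=> a /negPf na; rewrite big1 // => b _; rewrite na mulr0 mul0r mulr0.
  by move=> b /negPf nb; rewrite nb !mulr0.
- rewrite (bigD1 l) //= (bigD1 k) //= !eqxx !mulr1 mulrC !big1 ?addr0 //.
    by move=> a /negPf na; rewrite big1 // => b _; rewrite na mulr0 mul0r mulr0.
  by move=> b /negPf nb; rewrite nb !mulr0.
- rewrite mulr_sumr; apply: eq_bigr => a _.
  rewrite (bigD1 a) //= eqxx big1 ?addr0; first by rewrite mulr1 mulrC.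
  by move=> b /negPf nb; rewrite eq_sym nb mulr0 mul0r mulr0.
Qed.

(* [s], [f] are the input and the test vector, [s'], [f'] their conjugates; the nine summands
come from the tensor products of identity, transposition and trace. *)
Lemma mix_form (R : comNzRingType) (s s' f f' : 'I_2 -> 'I_2 -> R) p q r t u v :
  \sum_k \sum_k' \sum_l \sum_l' f' k k' * f l l' *
    (\sum_a \sum_b \sum_c \sum_d
       s a c * s' b d * (mix_coef p q r a b k l * mix_coef t u v c d k' l')) =
  p * t * form_id_id s s' f f' + q * u * form_id_id s s' f' f
  + p * u * (\sum_l \sum_l' (\sum_i f' i l * s i l') * (\sum_i f i l' * s' i l))
  + q * t * (\sum_l \sum_l' (\sum_i f' l i * s l' i) * (\sum_i f l' i * s' l i))
  + p * v * (\sum_l \sum_l' (\sum_i f' i l * s i l') * (\sum_i f i l * s' i l'))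
  + r * t * (\sum_l \sum_l' (\sum_i f' l i * s l' i) * (\sum_i f l i * s' l' i))
  + q * v * (\sum_l \sum_l' (\sum_i f i l * s i l') * (\sum_i f' i l * s' i l'))
  + r * u * (\sum_l \sum_l' (\sum_i f l i * s l' i) * (\sum_i f' l i * s' l' i))
  + r * v * ((\sum_a \sum_c f' a c * f a c) * (\sum_a \sum_c s' a c * s a c)).
Proof.
have e01 : (0 == 1 :> 'I_2) = false by [].
have e10 : (1 == 0 :> 'I_2) = false by [].
(* [M] is the inner sum after both contractions: first over [a], [b] with weights [p], [q], [r],
   then over [c], [d] with weights [t], [u], [v]. *)
pose M k k' l l' := t * (p * (s k k' * s' l l') + q * (s l k' * s' k l')
    + r * (k == l)%:R * \sum_a s a k' * s' a l')
  + u * (p * (s k l' * s' l k') + q * (s l l' * s' k k')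
    + r * (k == l)%:R * \sum_a s a l' * s' a k')
  + v * (k' == l')%:R * \sum_c (p * (s k c * s' l c) + q * (s l c * s' k c)
    + r * (k == l)%:R * \sum_a s a c * s' a c).
have E k k' l l' : \sum_a \sum_b \sum_c \sum_d
    s a c * s' b d * (mix_coef p q r a b k l * mix_coef t u v c d k' l') =
    M k k' l l'.
  under eq_bigr do under eq_bigr do under eq_bigr do
    under eq_bigr do rewrite mulrA.
  under eq_bigr do under eq_bigr do rewrite sum_mix_coef.
  rewrite /M.
  have H c d : \sum_a \sum_b s a c * s' b d * mix_coef p q r a b k l =
    p * (s k c * s' l d) + q * (s l c * s' k d) + r * (k == l)%:R * \sum_a s a c * s' a d.
    exact: (sum_mix_coef (fun a b => s a c * s' b d)).
  under eq_bigr do rewrite !big_split /= -!mulr_sumr.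
  rewrite !big_split /= -!mulr_sumr !H; congr (_ + _ * _).
  (* The trace on the second factor forces [d = c]; the sum over [c] moves outermost so that [H]
     applies to each term. *)
  transitivity (\sum_c \sum_a \sum_b s a c * s' b c * mix_coef p q r a b k l).
    rewrite [RHS]exchange_big; apply: eq_bigr => a _; exact: exchange_big.
  by rewrite (eq_bigr _ (fun c _ => H c c)) !big_split /= -!mulr_sumr.
under eq_bigr do under eq_bigr do under eq_bigr do under eq_bigr do rewrite E.
rewrite /form_id_id /M !sum_ord2 !eqxx e01 e10 ![true%:R]mulr1n ![false%:R]mulr0n.
ring.
Qed.

(** * Determinant bounds for the nine forms *)

Definition det2 (R : comNzRingType) (z : 'I_2 -> 'I_2 -> R) :=
  z 0 0 * z 1 1 - z 0 1 * z 1 0.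

Lemma det2_mul_col (R : comNzRingType) (x y : 'I_2 -> 'I_2 -> R) :
  det2 (fun l l' => \sum_i x i l * y i l') = det2 x * det2 y.
Proof. by rewrite /det2 !sum_ord2; ring. Qed.

Lemma det2_mul_row (R : comNzRingType) (x y : 'I_2 -> 'I_2 -> R) :
  det2 (fun l l' => \sum_i x l i * y l' i) = det2 x * det2 y.
Proof. by rewrite /det2 !sum_ord2; ring. Qed.

Lemma norm_AGM (a b : C) : 2 * (`|a| * `|b|) <= a * a^* + b * b^*.
Proof.
rewrite -!normCK -subr_ge0.
have -> : `|a| ^+ 2 + `|b| ^+ 2 - 2 * (`|a| * `|b|) = (`|a| - `|b|) ^+ 2 by ring.
by rewrite real_exprn_even_ge0 // rpredB // normr_real.
Qed.

(** AM-GM on the diagonal pair and on the off-diagonal pair, then the triangle inequality for the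
    determinant. *)
Lemma det2_frobenius (z : 'I_2 -> 'I_2 -> C) :
  2 * `|det2 z| <= \sum_l \sum_l' z l l' * (z l l')^*.
Proof.
have h : `|det2 z| <= `|z 0 0| * `|z 1 1| + `|z 0 1| * `|z 1 0|.
  by rewrite -!normrM ler_normB.
have := lerD (norm_AGM (z 0 0) (z 1 1)) (norm_AGM (z 0 1) (z 1 0)).
rewrite -mulrDr !sum_ord2 => h2.
apply: le_trans (_ : _ <= 2 * (`|z 0 0| * `|z 1 1| + `|z 0 1| * `|z 1 0|)) _.
  by rewrite ler_pM2l // ltr0n.
by apply: le_trans h2 _; rewrite le_eqVlt; apply/orP; left; apply/eqP; ring.
Qed.

(** With [t = z01 conj(z10)] the off-diagonal part is [2 Re t], at least [- 2 |t|], and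
    [|t| <= |z00 z11| + |det z|]. AM-GM on the diagonal pays for [2 |z00 z11|]. *)
Lemma det2_swap (z : 'I_2 -> 'I_2 -> C) :
  0 <= \sum_l \sum_l' z l l' * (z l' l)^* + 2 * `|det2 z|.
Proof.
set t := z 0 1 * (z 1 0)^*.
have -> : \sum_l \sum_l' z l l' * (z l' l)^* + 2 * `|det2 z| =
    (z 0 0 * (z 0 0)^* + z 1 1 * (z 1 1)^* - 2 * (`|z 0 0| * `|z 1 1|))
    + 2 * (`|det2 z| + `|z 0 0| * `|z 1 1| - `|t|) + (t + t^* + 2 * `|t|).
  by rewrite !sum_ord2 /t rmorphM /= conjCK; ring.
apply: addr_ge0; first apply: addr_ge0.
- by rewrite subr_ge0 norm_AGM.
- rewrite mulr_ge0 // subr_ge0 /t normrM norm_conjC -!normrM.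
  have -> : z 0 1 * z 1 0 = z 0 0 * z 1 1 - det2 z by rewrite /det2; ring.
  by rewrite (le_trans (ler_normB _ _)) // addrC.
- have rt : t + t^* \is Num.real by rewrite CrealE rmorphD /= conjCK addrC.
  have h : - (t + t^*) <= `|t| + `|t|.
    have := ler_normD t t^*; rewrite norm_conjC; apply: le_trans.
    by rewrite -normrN real_ler_norm // rpredN.
  by rewrite mulr_natl mulr2n -[t + _]opprK addrC subr_ge0.
Qed.

Lemma form_bounds (s f : 'I_2 -> 'I_2 -> C) :
  let s' a c := (s a c)^* in let f' a c := (f a c)^* in
  let d := `|det2 s| * `|det2 f| in
  [/\ 0 <= form_id_id s s' f f', 0 <= form_id_id s s' f' f,
      0 <= \sum_l \sum_l' (\sum_i f' i l * s i l') * (\sum_i f i l' * s' i l) + 2 * d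
    & 0 <= \sum_l \sum_l' (\sum_i f' l i * s l' i) * (\sum_i f l' i * s' l i) + 2 * d]
  /\ [/\ 0 <= \sum_l \sum_l' (\sum_i f' i l * s i l') * (\sum_i f i l * s' i l') - 2 * d,
      0 <= \sum_l \sum_l' (\sum_i f' l i * s l' i) * (\sum_i f l i * s' l' i) - 2 * d,
      0 <= \sum_l \sum_l' (\sum_i f i l * s i l') * (\sum_i f' i l * s' i l') - 2 * d,
      0 <= \sum_l \sum_l' (\sum_i f l i * s l' i) * (\sum_i f' l i * s' l' i) - 2 * d
    & 0 <= (\sum_a \sum_c f' a c * f a c) * (\sum_a \sum_c s' a c * s a c) - 4 * d].
Proof.
move=> s' f' d.
have conj_sum (x y : 'I_2 -> C) : (\sum_i x i * y i)^* = \sum_i (x i)^* * (y i)^*.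
  by rewrite rmorph_sum; apply: eq_bigr => i _; rewrite rmorphM.
have nf' : `|det2 f'| = `|det2 f|.
  by rewrite /det2 -!rmorphM -rmorphB norm_conjC.
(* Contracting the first or the second index, with [f] conjugated or not, gives four matrix products
   of determinant modulus [d]. The partial transpositions are swapped forms of [zA] and [zB]; the
   single traces are the squared Frobenius norms of all four. *)
pose zA l l' := \sum_i f' i l * s i l'.
have dA : d = `|det2 zA|.
  by rewrite det2_mul_col normrM nf' mulrC.
pose zB l l' := \sum_i f' l i * s l' i.
have dB : d = `|det2 zB|.
  by rewrite det2_mul_row normrM nf' mulrC.
pose zC l l' := \sum_i f i l * s i l'.
have dC : d = `|det2 zC|.
  by rewrite det2_mul_col normrM mulrC.
pose zD l l' := \sum_i f l i * s l' i.
have dD : d = `|det2 zD|.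
  by rewrite det2_mul_row normrM mulrC.
split; split.
- rewrite /form_id_id; have -> : \sum_a \sum_c f a c * s' a c = (\sum_a \sum_c f' a c * s a c)^*.
    by rewrite rmorph_sum /=; apply: eq_bigr => a _; rewrite conj_sum;
    apply: eq_bigr => i _; rewrite conjCK.
  exact: mul_conjC_ge0.
- rewrite /form_id_id; have -> : \sum_a \sum_c f' a c * s' a c = (\sum_a \sum_c f a c * s a c)^*.
    by rewrite rmorph_sum /=; apply: eq_bigr => a _; rewrite conj_sum.
  exact: mul_conjC_ge0.
- rewrite dA (_ : \sum_l _ = \sum_l \sum_l' zA l l' * (zA l' l)^*).
    exact: det2_swap.
  by apply: eq_bigr => l _; apply: eq_bigr => l' _; rewrite /zA conj_sum; congr (_ * _);
    apply: eq_bigr => i _; rewrite conjCK.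
- rewrite dB (_ : \sum_l _ = \sum_l \sum_l' zB l l' * (zB l' l)^*).
    exact: det2_swap.
  by apply: eq_bigr => l _; apply: eq_bigr => l' _; rewrite /zB conj_sum; congr (_ * _);
    apply: eq_bigr => i _; rewrite conjCK.
- rewrite subr_ge0 dA (le_trans (det2_frobenius _)) // le_eqVlt; apply/orP; left; apply/eqP.
  by apply: eq_bigr => l _; apply: eq_bigr => l' _; rewrite conj_sum; congr (_ * _);
    apply: eq_bigr => i _; rewrite conjCK.
- rewrite subr_ge0 dB (le_trans (det2_frobenius _)) // le_eqVlt; apply/orP; left; apply/eqP.
  by apply: eq_bigr => l _; apply: eq_bigr => l' _; rewrite conj_sum; congr (_ * _);
    apply: eq_bigr => i _; rewrite conjCK.
- rewrite subr_ge0 dC (le_trans (det2_frobenius _)) // le_eqVlt; apply/orP; left; apply/eqP.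
  by apply: eq_bigr => l _; apply: eq_bigr => l' _; rewrite conj_sum.
- rewrite subr_ge0 dD (le_trans (det2_frobenius _)) // le_eqVlt; apply/orP; left; apply/eqP.
  by apply: eq_bigr => l _; apply: eq_bigr => l' _; rewrite conj_sum.
- rewrite subr_ge0.
  (* The double trace is a product of two squared Frobenius norms, each bounded on its own. *)
  have -> : 4 * d = (2 * `|det2 f|) * (2 * `|det2 s|) by rewrite /d; ring.
  rewrite ler_pM ?mulr_ge0 //; first rewrite (le_trans (det2_frobenius _)) //;
    last rewrite (le_trans (det2_frobenius _)) //.
  all: rewrite le_eqVlt; apply/orP; left; apply/eqP.
  all: by apply: eq_bigr => l _; apply: eq_bigr => l' _; rewrite mulrC.
Qed.

(** * Positivity of products of qubit maps *)

Definition mixmap (p q r : C) (X : 'M[C]_2) : 'M[C]_2 :=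
  p *: X + q *: X^T + r *: (\tr X)%:M.

Lemma is_lin_mixmap p q r : is_lin (mixmap p q r).
Proof.
move=> a X Y; apply/matrixP=> i j; rewrite !mxE mxtraceD mxtraceZ.
by case: (i == j); rewrite ?mulr1n ?mulr0n; ring.
Qed.

Lemma mixmap_delta p q r a b k l :
  mixmap p q r (delta_mx a b) k l = mix_coef p q r a b k l.
Proof.
rewrite /mixmap /mix_coef !mxE (eq_sym k a) (eq_sym l b) (eq_sym l a) (eq_sym k b).
have -> : \tr (delta_mx a b : 'M[C]_2) = (a == b)%:R.
  rewrite /mxtrace (bigD1 a) //= big1 ?mxE ?eqxx ?addr0 // => i /negPf ni.
  by rewrite mxE ni.
by rewrite -!mulnb !natrM -[_%:R *+ (k == l)]mulr_natr !mulrA.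
Qed.

Lemma adj_mixmap p q r X : 0 <= p -> 0 <= q -> 0 <= r ->
  adjmx (mixmap p q r (adjmx X)) = mixmap p q r X.
Proof.
move=> p0 q0 r0; apply/matrixP=> i j.
have trX : \tr (adjmx X) = (\tr X)^*.
  by rewrite /mxtrace rmorph_sum; apply: eq_bigr => k _; rewrite adjmxE.
rewrite /mixmap trX adjmxE !mxE !rmorphD !rmorphM rmorphMn /= !conjCK !geC0_conj //.
by rewrite eq_sym.
Qed.

(** Provides the hermitian half of [psd] for the image of a hermitian matrix. *)
Lemma adj_tens_map n1 m1 n2 m2
    (L1 : 'M[C]_n1 -> 'M[C]_m1) (L2 : 'M[C]_n2 -> 'M[C]_m2) X :
  is_lin L1 -> is_lin L2 ->
  (forall A, adjmx (L1 (adjmx A)) = L1 A) ->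
  (forall A, adjmx (L2 (adjmx A)) = L2 A) ->
  adjmx (tens_map L1 L2 (adjmx X)) = tens_map L1 L2 X.
Proof.
move=> l1 l2 h1 h2; have l12 := is_lin_tens_map L1 L2.
apply: (lin_tens_ext (F := fun X => adjmx (tens_map L1 L2 (adjmx X)))) => //.
  by move=> a A B; rewrite adjmxD adjmxZ l12 adjmxD adjmxZ conjCK.
by move=> A B; rewrite adjmx_tens !tens_mapT // adjmx_tens h1 h2.
Qed.

Lemma sum_mxtens (V : nmodType) m n (F : 'I_(m * n) -> V) :
  \sum_i F i = \sum_i \sum_j F (mxtens_index (i, j)).
Proof.
rewrite pair_big (reindex (@mxtens_index m n)) /=; last first.
  by exists (@mxtens_unindex m n) => ? _; rewrite ?mxtens_indexK ?mxtens_unindexK.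
by apply: eq_bigr => -[].
Qed.

Lemma formE n (A : 'M[C]_n) (w : 'cV[C]_n) :
  (adjmx w *m A *m w) 0 0 = \sum_k \sum_l (w k 0)^* * w l 0 * A k l.
Proof.
rewrite mxE exchange_big; apply: eq_bigr => l _; rewrite mxE mulr_suml.
by apply: eq_bigr => k _; rewrite adjmxE mulrAC.
Qed.

Lemma weighted_form_ge0 (p q r t u v d F1 F2 F3 F4 F5 F6 F7 F8 F9 : C) :
  0 <= p -> 0 <= q -> 0 <= r -> 0 <= t -> 0 <= u -> 0 <= v ->
  p * u + q * t <= p * v + r * t + q * v + r * u + 2 * (r * v) ->
  0 <= d -> 0 <= F1 -> 0 <= F2 -> 0 <= F3 + 2 * d -> 0 <= F4 + 2 * d ->
  0 <= F5 - 2 * d -> 0 <= F6 - 2 * d -> 0 <= F7 - 2 * d -> 0 <= F8 - 2 * d ->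
  0 <= F9 - 4 * d ->
  0 <= p * t * F1 + q * u * F2 + p * u * F3 + q * t * F4 + p * v * F5 +
       r * t * F6 + q * v * F7 + r * u * F8 + r * v * F9.
Proof.
move=> p0 q0 r0 t0 u0 v0; rewrite -subr_ge0 => h d0 h1 h2 h3 h4 h5 h6 h7 h8 h9.
(* Each form is shifted by its own bound. The shifts leave a multiple of [d] whose coefficient is
   the slack in the assumed inequality: gains from the traces minus losses from the partial
   transpositions. *)
have -> : p * t * F1 + q * u * F2 + p * u * F3 + q * t * F4 + p * v * F5 +
   r * t * F6 + q * v * F7 + r * u * F8 + r * v * F9 =
   p * t * F1 + q * u * F2 + p * u * (F3 + 2 * d) + q * t * (F4 + 2 * d)
   + p * v * (F5 - 2 * d) + r * t * (F6 - 2 * d) + q * v * (F7 - 2 * d)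
   + r * u * (F8 - 2 * d) + r * v * (F9 - 4 * d)
   + 2 * ((p * v + r * t + q * v + r * u + 2 * (r * v) - (p * u + q * t)) * d).
  by ring.
by rewrite !addr_ge0 // ?mulr_ge0 // ?mulr_ge0 // ?mulr_ge0.

Qed.

Lemma tens_mixmap_positive (p q r t u v : C) :
  0 <= p -> 0 <= q -> 0 <= r -> 0 <= t -> 0 <= u -> 0 <= v ->
  p * u + q * t <= p * v + r * t + q * v + r * u + 2 * (r * v) ->
  positive_map (tens_map (mixmap p q r) (mixmap t u v)).
Proof.
move=> p0 q0 r0 t0 u0 v0 h.
apply: positive_map_outer => [|psi]; first exact: is_lin_tens_map.
split.
  rewrite -[in LHS](adj_tens_map (L1 := mixmap p q r)) ?adjmxK; first last.
  - by move=> A; exact: adj_mixmap.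
  - by move=> A; exact: adj_mixmap.
  - exact: is_lin_mixmap.
  - exact: is_lin_mixmap.
  by rewrite adjmxM adjmxK.
move=> phi.
pose s a c := psi (mxtens_index (a, c)) 0.
pose f a c := phi (mxtens_index (a, c)) 0.
pose s' a c := (s a c)^*; pose f' a c := (f a c)^*.
have -> : (adjmx phi *m tens_map (mixmap p q r) (mixmap t u v) (psi *m adjmx psi)
            *m phi) 0 0 =
  \sum_k \sum_k' \sum_l \sum_l' f' k k' * f l l' *
    (\sum_a \sum_b \sum_c \sum_d
       s a c * s' b d * (mix_coef p q r a b k l * mix_coef t u v c d k' l')).
  rewrite formE sum_mxtens; apply: eq_bigr => k _; apply: eq_bigr => k' _.
  rewrite sum_mxtens; apply: eq_bigr => l _; apply: eq_bigr => l' _.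
  congr (_ * _); rewrite summxE; apply: eq_bigr => a _.
  rewrite summxE; apply: eq_bigr => b _.
  rewrite summxE; apply: eq_bigr => c _.
  rewrite summxE; apply: eq_bigr => d _.
  by rewrite mxE tensmxE !mixmap_delta mxE big_ord1 adjmxE.
rewrite mix_form.
have [[h1 h2 h3 h4] [h5 h6 h7 h8 h9]] := form_bounds s f.
exact: (weighted_form_ge0 p0 q0 r0 t0 u0 v0 h (mulr_ge0 (normr_ge0 _) (normr_ge0 _))
         h1 h2 h3 h4 h5 h6 h7 h8 h9).
Qed.

(** * The lattice state and its exact evaluation *)

(* The real matrices I, X, Z, and [[0, -1], [1, 0]] in place of Y, numbered I, X, Y, Z. *)
Definition pauli (a : nat) (k i : bool) : int :=
  match a with
  | 0 => (k == i)%:R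
  | 1 => (k != i)%:R
  | 2 => (k != i)%:R * (-1) ^+ i
  | _ => (k == i)%:R * (-1) ^+ k
  end.

(** A tensor product of two matrices [pauli], read as a vector: a product of two unnormalised Bell
    vectors. *)
Definition pauli_pair (ab : nat * nat) (s : (bool * bool) * (bool * bool)) : int :=
  pauli ab.1 s.2.1 s.1.1 * pauli ab.2 s.2.2 s.1.2.

(* Entries of the unnormalised sum of projectors on the products of Bell vectors in [r]; an
index is a pair of input bits followed by a pair of output bits. *)
Definition lattice_state (r : seq (nat * nat)) s t : int :=
  foldr +%R 0 [seq pauli_pair ab s * pauli_pair ab t | ab <- r].

Definition lattice : seq (nat * nat) :=
  [:: (0, 2); (1, 1); (1, 2); (1, 3); (2, 1); (3, 3)]%N.

(** The six pairs whose projectors sum to the partial transpose of the state given by [lattice]. *)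
Definition lattice_dual : seq (nat * nat) :=
  [:: (2, 2); (2, 0); (0, 2); (0, 3); (1, 2); (1, 1)]%N.

(** Exchanging the outputs [k] and [l] is partial transposition, so this is the PPT property. It is
    checked at all 256 choices of bits. *)
Lemma lattice_state_transpose i j k l :
  lattice_state lattice (i, l) (j, k) = lattice_state lattice_dual (i, k) (j, l).
Proof.
by move: i j k l => [[] []] [[] []] [[] []] [[] []]; vm_compute.
Qed.

(** Integer counterpart of [mix_coef] on bits, for evaluation; [mix_coef_int] transfers the result
    to [C]. *)
Definition int_mix_coef (p q r : int) (a b k l : bool) : int :=
  p * (a == k)%:R * (b == l)%:R + q * (a == l)%:R * (b == k)%:R
  + r * (a == b)%:R * (k == l)%:R.

Definition sum_bool (F : bool -> int) := F true + F false.

Lemma sum_bool4 (F : (bool * bool) * (bool * bool) -> int) :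
  \sum_s F s = sum_bool (fun a => sum_bool (fun b =>
                 sum_bool (fun c => sum_bool (fun d => F ((a, b), (c, d)))))).
Proof.
have sum_pair (I J : finType) (G : I * J -> int) :
    \sum_s G s = \sum_i \sum_j G (i, j).
  by rewrite pair_big; apply: eq_bigr => -[].
by rewrite /sum_bool sum_pair sum_pair !big_bool /= !sum_pair !big_bool.
Qed.

(** The first tensor factor carries the qubit map with weights 6, 0, 1 and the second the one with
    weights 2, 2, 1. *)
Lemma lattice_value :
  \sum_s \sum_t lattice_state lattice s t *
    (int_mix_coef 6 0 1 s.1.1 t.1.1 s.2.1 t.2.1 *
     int_mix_coef 2 2 1 s.1.2 t.1.2 s.2.2 t.2.2) = - 8.
Proof.
under eq_bigr do rewrite sum_bool4.
rewrite sum_bool4.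
by vm_compute.
Qed.

(** * The block diagonal map, its decomposability and the positivity of its square *)

Lemma completely_positive_comp n m p (L : 'M[C]_n -> 'M[C]_m) (M : 'M[C]_p -> 'M[C]_n) :
  completely_positive L -> completely_positive M ->
  completely_positive (fun X => L (M X)).
Proof.
move=> [lL pL] [lM pM]; have lLM := is_lin_comp lL lM; split=> // k A pA.
rewrite (lin_tens_ext (G := fun X => tens_map id L (tens_map id M X))).
- by apply: pL; exact: pM.
- exact: is_lin_tens_map.
- by apply: is_lin_comp; exact: is_lin_tens_map.
- by move=> X Y; rewrite !tens_mapT.
Qed.

(** Kraus form: the trace part [(tr X) 1] is the sum of [E_ij X E_ij^*] over all matrix units. *)
Lemma completely_positive_mixmap p r :
  0 <= p -> 0 <= r -> completely_positive (mixmap p 0 r).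
Proof.
move=> p0 r0.
apply: (eq_completely_positive (L := fun X : 'M[C]_2 => p *: (1%:M *m X *m adjmx 1%:M)
  + r *: \sum_i \sum_j delta_mx i j *m X *m adjmx (delta_mx i j))).
  move=> X; rewrite /mixmap scale0r addr0 mul1mx /adjmx trmx1 map_mx1 mulmx1.
  have E i j : delta_mx i j *m X *m adjmx (delta_mx i j) = X j j *: delta_mx i i.
    apply/matrixP=> k l; rewrite mxE (bigD1 j) //= big1 ?addr0; last first.
      by move=> m /negPf mj; rewrite !mxE mj andbF conjC0 mulr0.
    rewrite mxE (bigD1 j) //= big1 ?addr0; last first.
      by move=> m /negPf mj; rewrite !mxE mj andbF mul0r.
    by rewrite !mxE !eqxx !andbT rmorph_nat mulrAC -natrM mulnb mulrC.
  under eq_bigr do under eq_bigr do rewrite E.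
  congr (_ + _ *: _); under eq_bigr do rewrite -scaler_suml.
  rewrite -scaler_sumr -/(\tr X) -scalemx1; congr (_ *: _).
  apply/matrixP=> k l; rewrite sum_ord2 !mxE -!val_eqE.
  by case: k l => [[|[|k]] ?] [[|[|l]] ?] //; rewrite /= ?addr0 ?add0r.
apply: completely_positiveD; apply: completely_positiveZ => //.
  exact: completely_positive_conj.
by do 2![apply: completely_positive_sum => ?]; exact: completely_positive_conj.
Qed.

(** For real [V] the transposition commutes past the conjugation, which isolates the completely
    copositive part. *)
Lemma conj_mixmap m (V : 'M[C]_(m, 2)) p q r Y : adjmx V = V^T ->
  V *m mixmap p q r Y *m adjmx V =
  V *m mixmap p 0 r Y *m adjmx V + (q *: (V *m Y *m adjmx V))^T.
Proof.
move=> V_real; rewrite V_real linearZ /= !trmx_mul trmxK.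
have -> : mixmap p q r Y = mixmap p 0 r Y + q *: Y^T.
  by rewrite /mixmap scale0r addr0 addrAC.
by rewrite mulmxDr mulmxDl -scalemxAr -scalemxAl mulmxA.
Qed.

Section Construction.
Variables (d1 d2 : nat) (h1 : (2 <= d1)%N) (h2 : (4 <= d2)%N).

Definition embed_in (i : 'I_2) : 'I_d1 := widen_ord h1 i.

(** The blocks occupy coordinates 0, 1 and 2, 3 of the output, whence [4 <= d2]. *)
Lemma embed_out_subproof (b : bool) (i : 'I_2) : (b.*2 + i < d2)%N.
Proof. by apply: leq_trans h2; case: b i => -[[|[|[]]]]. Qed.

Definition embed_out b i : 'I_d2 := Ordinal (embed_out_subproof b i).

Definition compress_mx : 'M[C]_(2, d1) := \matrix_(i, j) (embed_in i == j)%:R.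

Definition block_mx_of b : 'M[C]_(d2, 2) := \matrix_(k, i) (k == embed_out b i)%:R.

Definition blockmap (b : bool) : 'M[C]_2 -> 'M[C]_2 :=
  if b then mixmap 2 2 1 else mixmap 6 0 1.

Definition block_sum (X : 'M[C]_d1) : 'M[C]_d2 :=
  \sum_b block_mx_of b *m blockmap b (compress_mx *m X *m adjmx compress_mx)
           *m adjmx (block_mx_of b).

Lemma is_lin_blockmap b : is_lin (blockmap b).
Proof. by case: b; exact: is_lin_mixmap. Qed.

Lemma is_lin_block_sum : is_lin block_sum.
Proof.
apply: is_lin_sum => b; apply: (is_lin_comp (is_lin_conj _ _)).
by apply: (is_lin_comp (@is_lin_blockmap b)); exact: is_lin_conj.
Qed.

Lemma embed_out_eq b b' i i' :
  (embed_out b i == embed_out b' i') = (b == b') && (i == i').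
Proof.
rewrite -!val_eqE /=.
by case: b b' i i' => [] [] [[|[|i]] hi] [[|[|i']] hi'].
Qed.

Lemma compress_delta i j :
  compress_mx *m delta_mx (embed_in i) (embed_in j) *m adjmx compress_mx = delta_mx i j.
Proof.
apply/matrixP=> k l; rewrite mxE (bigD1 (embed_in j)) //= big1 ?addr0; last first.
  move=> m /negPf mj; rewrite mxE (bigD1 (embed_in i)) //= big1 ?addr0.
    by rewrite !mxE mj andbF mulr0 mul0r.
  by move=> m' /negPf mi; rewrite !mxE mi mulr0.
rewrite mxE (bigD1 (embed_in i)) //= big1 ?addr0; last first.
  by move=> m' /negPf mi; rewrite !mxE mi mulr0.
rewrite !mxE !eqxx mulr1 rmorph_nat -natrM mulnb.
by congr (_ && _)%:R; apply/eqP/eqP=> [/(congr1 val)/= /val_inj|->].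
Qed.

Lemma block_entry b b' (Y : 'M[C]_2) k l :
  (block_mx_of b' *m Y *m adjmx (block_mx_of b')) (embed_out b k) (embed_out b l)
  = if b == b' then Y k l else 0.
Proof.
rewrite mxE (bigD1 l) //= big1 ?addr0; last first.
  move=> m /negPf ml; rewrite !mxE embed_out_eq [l == m]eq_sym ml andbF.
  by rewrite conjC0 mulr0.
rewrite adjmxE mxE (bigD1 k) //= big1 ?addr0; last first.
  by move=> m /negPf mk; rewrite !mxE embed_out_eq [k == m]eq_sym mk andbF mul0r.
rewrite !mxE !embed_out_eq !eqxx !andbT.
by case: (b == b'); rewrite ?conjC0 ?conjC1 ?mulr1 ?mul1r ?mulr0.
Qed.

(** Compressing to one diagonal block recovers the qubit map of that block. *)
Lemma block_sum_delta b i j k l :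
  block_sum (delta_mx (embed_in i) (embed_in j)) (embed_out b k) (embed_out b l)
  = blockmap b (delta_mx i j) k l.
Proof.
rewrite /block_sum compress_delta summxE big_bool /= !block_entry.
by case: b; rewrite /= ?addr0 ?add0r.
Qed.

(** Only block [true] has a transposition term, which becomes [S]; the identity and trace terms of
    both blocks form [T]. *)
Lemma decomposable_block_sum : decomposable block_sum.
Proof.
exists (fun X => \sum_b block_mx_of b *m
   (if b then mixmap 2 0 1 else mixmap 6 0 1) (compress_mx *m X *m adjmx compress_mx)
     *m adjmx (block_mx_of b)).
exists (fun X => 2 *: (block_mx_of true *m (compress_mx *m X *m adjmx compress_mx)
                         *m adjmx (block_mx_of true))).
split; [|split].
- apply: completely_positive_sum => b.
  apply: (completely_positive_comp (completely_positive_conj _)).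
  apply: completely_positive_comp (completely_positive_conj _).
  by case: b; apply: completely_positive_mixmap; rewrite ?ler0n ?ler01.
- apply: completely_positiveZ; first by rewrite ler0n.
  apply: (completely_positive_comp (completely_positive_conj _)).
  exact: completely_positive_conj.
move=> X; rewrite /block_sum.
rewrite [in LHS]big_bool [in RHS]big_bool /blockmap.
have V_real : adjmx (block_mx_of true) = (block_mx_of true)^T.
  by apply/matrixP=> i j; rewrite !mxE rmorph_nat.
exact: (etrans (congr1 (+%R^~ _) (conj_mixmap 2 2 1 _ V_real)) (addrAC _ _ _)).
Qed.

(** The tensor square splits into four products of qubit maps, each preceded by a compression and
    followed by an embedding. *)
Lemma block_sum_tens_positive : positive_map (tens_map block_sum block_sum).
Proof.
have lP := is_lin_block_sum; have lb := is_lin_blockmap.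
move=> A pA; pose R2 := compress_mx *t compress_mx.
pose V2 b b' := block_mx_of b *t block_mx_of b'.
rewrite (lin_tens_ext (G := fun X => \sum_b \sum_b' V2 b b' *m
  tens_map (blockmap b) (blockmap b') (R2 *m X *m adjmx R2) *m adjmx (V2 b b'))).
- apply: psd_sum => b; apply: psd_sum => b'; apply: psd_conj.
  have pos : positive_map (tens_map (blockmap b) (blockmap b')).
    (* The inequality between the weights reads [0 <= 14] for two blocks [false], [8 <= 10] for two
       blocks [true], and [12 <= 12] for the mixed pairs: the weights 6 and 2 are tight there. *)
    by case: b b' => [] []; apply: tens_mixmap_positive;
      rewrite ?ler0n ?lexx ?ler01 ?mulr0 ?mul0r ?addr0 ?add0r ?mulr1 ?mul1r
        -?natrM -?natrD ?ler_nat ?ler0n.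
  by apply: pos; exact: psd_conj.
- exact: is_lin_tens_map.
- do 2![apply: is_lin_sum => ?]; apply: (is_lin_comp (is_lin_conj _ _)).
  by apply: (is_lin_comp (is_lin_tens_map _ _)); exact: is_lin_conj.
move=> X Y; rewrite tens_mapT // /block_sum tensmx_suml.
apply: eq_bigr => b _; rewrite tensmx_sumr; apply: eq_bigr => b' _.
by rewrite /V2 /R2 !adjmx_tens !tensmx_mul tens_mapT // !tensmx_mul.
Qed.

End Construction.

(** * Pairing with the lattice state as a test of decomposability *)

Section Witness.
Variables (n m : nat) (e : bool * bool -> 'I_n) (f : bool * bool -> 'I_m).

(** Pairing of the Choi matrix of [L], restricted to four input and four output labels, with the
    lattice state of [r]. *)
Definition witness (r : seq (nat * nat)) (L : 'M[C]_n -> 'M[C]_m) : C :=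
  \sum_s \sum_t (lattice_state r s t)%:~R
    * L (delta_mx (e s.1) (e t.1)) (f s.2) (f t.2).

(** Induction on [r]: each projector contributes the form of the Choi matrix at one product of Bell
    vectors. *)
Lemma witness_ge0 r L : completely_positive L -> 0 <= witness r L.
Proof.
move=> pL; elim: r => [|ab r IHr].
  by rewrite /witness big1 // => s _; rewrite big1 // => t _; rewrite mul0r.
have -> : witness (ab :: r) L = \sum_s \sum_t
    ((pauli_pair ab s)%:~R)^* * (pauli_pair ab t)%:~R
      * L (delta_mx (e s.1) (e t.1)) (f s.2) (f t.2) + witness r L.
  rewrite -big_split; apply: eq_bigr => s _; rewrite -big_split; apply: eq_bigr => t _.
  by rewrite /= -mulrDl rmorph_int -intrM -intrD.
apply: addr_ge0 => //.
exact: (completely_positive_choi (fun s => e s.1) (fun s => f s.2)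
         (fun s => (pauli_pair ab s)%:~R)).
Qed.

Lemma witness_transpose L :
  witness lattice (fun X => (L X)^T) = witness lattice_dual L.
Proof.
rewrite /witness !pair_big /=.
(* Exchanging the output labels of the two indices moves the transposition from the map to the
   state. *)
pose swap (st : (bool * bool * (bool * bool)) * (bool * bool * (bool * bool))) :=
  ((st.1.1, st.2.2), (st.2.1, st.1.2)).
have swapK : involutive swap by move=> [[i k] [j l]].
rewrite (reindex_inj (inv_inj swapK)); apply: eq_bigr => -[[i k] [j l]] _ /=.
by rewrite mxE lattice_state_transpose.
Qed.

(** [T] is paired with the state and [S] with its partial transpose; both are sums of projectors. *)
Lemma witness_decomposable L : decomposable L -> 0 <= witness lattice L.
Proof.
move=> [T [S [pT [pS eL]]]].
have -> : witness lattice L = witness lattice T + witness lattice_dual S.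
  rewrite -witness_transpose -big_split; apply: eq_bigr => s _.
  rewrite -big_split; apply: eq_bigr => t _.
  by rewrite eL mxE mulrDr.
by apply: addr_ge0; exact: witness_ge0.
Qed.
End Witness.

Definition ord_bool (b : bool) : 'I_2 := if b then 1 else 0.

Lemma mix_coef_int (p q r : int) a b k l :
  mix_coef p%:~R q%:~R r%:~R (ord_bool a) (ord_bool b) (ord_bool k) (ord_bool l)
  = (int_mix_coef p q r a b k l)%:~R :> C.
Proof.
have E x y : (ord_bool x == ord_bool y)%:R = ((x == y)%:R : int)%:~R :> C.
  by case: x y => [] [].
by rewrite /mix_coef /int_mix_coef !E !intrD !intrM.
Qed.

Lemma block_sum_not_decomposable d1 d2 (h1 : (2 <= d1)%N) (h2 : (4 <= d2)%N) :
  ~ decomposable (tens_map (block_sum h1 h2) (block_sum h1 h2)).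
Proof.
pose e (x : bool * bool) :=
  mxtens_index (embed_in h1 (ord_bool x.1), embed_in h1 (ord_bool x.2)).
(* Outputs lie in block [false] on the first factor and in block [true] on the second, so the test
   sees the product of the two different qubit maps. *)
pose f (x : bool * bool) :=
  mxtens_index (embed_out h2 false (ord_bool x.1), embed_out h2 true (ord_bool x.2)).
move=> /(witness_decomposable e f).
have lP := is_lin_block_sum h1 h2.
rewrite (_ : witness _ _ _ _ = (\sum_s \sum_t lattice_state lattice s t *
    (int_mix_coef 6 0 1 s.1.1 t.1.1 s.2.1 t.2.1 *
     int_mix_coef 2 2 1 s.1.2 t.1.2 s.2.2 t.2.2))%:~R).
  by rewrite lattice_value ler0z.
rewrite /witness raddf_sum; apply: eq_bigr => s _.
rewrite raddf_sum; apply: eq_bigr => t _.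
rewrite /= 2!intrM -!mix_coef_int; congr (_ * _).
rewrite /e /f tens_map_unit // tensmxE (block_sum_delta h1 h2 false)
  (block_sum_delta h1 h2 true).
by rewrite !mixmap_delta.
Qed.

Theorem mainTheorem20 (d1 d2 : nat) (h1 : (2 <= d1)%N) (h2 : (4 <= d2)%N) :
  exists P : 'M[C]_d1 -> 'M[C]_d2,
    is_lin P /\ decomposable P /\
    positive_map (tens_map P P) /\ ~ decomposable (tens_map P P).
Proof.
exists (block_sum h1 h2); split; first exact: is_lin_block_sum.
split; first exact: decomposable_block_sum.
by split; [exact: block_sum_tens_positive|exact: block_sum_not_decomposable].
Qed.
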